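(* Let $G$ be an $n$-vertex PLB graph with parameters $\alpha$ and $t$. Then algorithm MaximalClique finds the largest clique in $G$ (i.e., returns the maximum clique size) in $\exp(O(n^{1/\alpha}(t+1)^{1-1/\alpha}))$ time.
   Context: Graphs are finite, simple, undirected; $n$ is the number of vertices. Fix a universal constant $c_1>0$. An $n$-vertex graph $G$ is power law bounded (PLB) with parameters $\alpha$ and $t$ ($\alpha>1$ a constant, $t\ge0$ real) if for every integer $d\ge0$ the number of vertices $v$ with $\deg(v)\in[2^d,2^{d+1})$ is at most $c_1n(t+1)^{\alpha-1}\sum_{i=2^d}^{2^{d+1}-1}(i+t)^{-\alpha}$. $O(\cdot)$ hides constants depending only on $c_1,\alpha$. Let $\vec G$ be obtained by sorting vertices in non-decreasing order of degree and orienting each edge towards its later endpoint. Algorithm MaximalClique($G$): build $\vec G$; set $m:=0$; for each vertex $v$, let $N_v$ be $\{v\}$ together with the out-neighbors of $v$ in $\vec G$; for every subset $S\subseteq N_v$, if $S$ is a clique in $G$ set $m:=\max(m,|S|)$; return $m$. *)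

(* Defs.v *)
From HB Require Import structures.
From mathcomp Require Import all_boot all_order all_algebra.
From mathcomp Require Import all_classical all_reals all_analysis.
Set Implicit Arguments.
Unset Strict Implicit.
Unset Printing Implicit Defensive.
Import Order.TTheory GRing.Theory Num.Theory.

(* A finite simple graph is a symmetric irreflexive relation e on a finType. *)

Section Graphs.
Variables (T : finType) (e : rel T).

Definition deg (v : T) : nat := #|[set u | e v u]|.

Definition is_clique (S : {set T}) : bool :=
  [forall x in S, forall y in S, (x != y) ==> e x y].

Definition clique_number : nat := \max_(S : {set T} | is_clique S) #|S|.

Definition power_law_bounded (R : realType) (c1 alpha t : R) : Prop :=
  forall d : nat,
    (#|[set v | (2 ^ d <= deg v < 2 ^ d.+1)%N]|%:R <=
     c1 * #|T|%:R * (t + 1) `^ (alpha - 1) *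
     \sum_(2 ^ d <= i < 2 ^ d.+1) (i%:R + t) `^ (- alpha))%R.

End Graphs.

(* A computation returns a value and the number of elementary operations      *)
(* executed. The model is a unit-cost RAM: an adjacency query, a comparison,  *)
(* an arithmetic or Boolean operation, an assignment, and the construction of *)
(* a list cell or a pair cost one step each, written [step], and so does each *)
(* iteration of a loop. [ret] and [bind] only carry values around.            *)

Definition timed (A : Type) : Type := (A * nat)%type.
Definition result A (c : timed A) : A := c.1.
Definition time A (c : timed A) : nat := c.2.

Definition ret A (a : A) : timed A := (a, 0).
Definition step A (a : A) : timed A := (a, 1).
Definition bind A B (c : timed A) (k : A -> timed B) : timed B :=
  (result (k (result c)), time c + time (k (result c))).

Notation "'let*' x := c 'in' k" := (bind c (fun x => k))
  (at level 200, x name, c at level 200, k at level 200).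

Fixpoint for_each A S (l : seq A) (body : A -> S -> timed S) (s : S) :
    timed S :=
  if l is x :: l' then
    let* s0 := step s in
    let* s' := body x s0 in
    for_each l' body s'
  else ret s.

(* Runs body on S0 extended by X, for each of the 2 ^ size N sublists X of N. *)
Fixpoint for_each_subset A S (N S0 : seq A) (body : seq A -> S -> timed S)
    (s : S) : timed S :=
  if N is x :: N' then
    let* s' := for_each_subset N' S0 body s in
    let* S1 := step (x :: S0) in
    for_each_subset N' S1 body s'
  else body S0 s.

Section Algorithm.
Variables (T : Type) (e : rel T).

(* The input is the adjacency relation e, answering queries in unit time, and *)
(* a list of all the vertices.                                                *)

Definition compute_degree (vs : seq T) (v : T) : timed nat :=
  for_each vs
    (fun u k => let* b := step (e v u) in if b then step k.+1 else ret k) 0.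

Fixpoint insert (x : nat * T) (l : seq (nat * T)) : timed (seq (nat * T)) :=
  if l is y :: l' then
    let* b := step (x.1 <= y.1) in
    if b then step (x :: l) else let* r := insert x l' in step (y :: r)
  else step [:: x].

(* Insertion sort on (degree, vertex) pairs. Vertices of equal degree are     *)
(* ordered according to their positions in vs.                                *)
Definition sort_by_degree (vs : seq T) : timed (seq (nat * T)) :=
  for_each vs
    (fun v l =>
      let* k := compute_degree vs v in
      let* x := step (k, v) in
      insert x l) [::].

Definition out_neighbors (v : T) (later : seq (nat * T)) : timed (seq T) :=
  for_each later
    (fun u out =>
      let* b := step (e v u.2) in if b then step (u.2 :: out) else ret out)
    [::].

(* The oriented graph, as the list of vertices with their out-neighbors.      *)
Fixpoint orient (l : seq (nat * T)) : timed (seq (T * seq T)) :=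
  if l is v :: later then
    let* out := out_neighbors v.2 later in
    let* p := step (v.2, out) in
    let* r := orient later in
    step (p :: r)
  else ret [::].

Definition build_oriented (vs : seq T) : timed (seq (T * seq T)) :=
  let* l := sort_by_degree vs in orient l.

Definition adjacent_to_all (x : T) (S : seq T) : timed bool :=
  for_each S (fun y b => let* a := step (e x y) in step (b && a)) true.

Fixpoint test_clique (S : seq T) : timed bool :=
  if S is x :: S' then
    let* b := adjacent_to_all x S' in
    let* b' := test_clique S' in
    step (b && b')
  else ret true.

Definition compute_size (S : seq T) : timed nat :=
  for_each S (fun _ k => step k.+1) 0.

Definition MaximalClique (vs : seq T) : timed nat :=
  let* G := build_oriented vs in
  let* m0 := step 0 in
  for_each G
    (fun p m =>
      let* Nv := step (p.1 :: p.2) in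
      for_each_subset Nv [::]
        (fun S m' =>
          let* b := test_clique S in
          if b then let* k := compute_size S in step (maxn m' k) else ret m')
        m)
    m0.

End Algorithm.

(* Main.v *)
(* A vertex of out-degree k has k out-neighbours, all of degree at least k.     *)
(* Summing the power law bound over the dyadic blocks from 2 ^ a on, where      *)
(* 2 ^ a <= k < 2 ^ (a + 1), gives a geometric series of ratio                  *)
(* 2 `^ (1 - alpha) < 1, so that k <= O(n (t + 1) `^ (alpha - 1) k `^ (1 - alpha)) *)
(* and hence k = O(n `^ (1 / alpha) (t + 1) `^ (1 - 1 / alpha)). The running    *)
(* time is polynomial in n times exponential in the largest out-degree, and the *)
(* polynomial is absorbed since n `^ (1 / alpha) dominates ln n. The largest    *)
(* clique is found at its first vertex in the order, whose out-neighbours       *)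
(* include all the others.                                                      *)
Require Import Defs.
From HB Require Import structures.
From mathcomp Require Import all_boot all_order all_algebra.
From mathcomp Require Import all_classical all_reals all_analysis.
From mathcomp Require Import zify ring lra.
Set Implicit Arguments.
Unset Strict Implicit.
Unset Printing Implicit Defensive.
Import Order.TTheory GRing.Theory Num.Theory.
Local Open Scope ring_scope.

(** Correctness ([MaximalClique_correct]): every scored list is a clique, so the result never
    exceeds the clique number. Conversely a maximum clique lies inside [N_v] for its earliest vertex
    [v] in the degree order, and all sublists of [N_v] are tried.

    Time: with all out-degrees at most K, [time_MaximalClique] gives O(n^2 8^K). An out-degree k
    forces k vertices of degree at least k ([outdegree_card]), and the power law then forces k <= M
    X with X = n^(1/alpha) (t+1)^(1-1/alpha) ([outdegree_bound]). Finally n <= exp(alpha X)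
    ([natr_le_expR]) moves the polynomial factor into the exponent. *)

Arguments bind : simpl never.
Arguments result : simpl never.
Arguments time : simpl never.

(** * Results and costs of the loop combinators *)

Section Loops.
Local Open Scope nat_scope.

Lemma result_bind A B (c : timed A) (k : A -> timed B) :
  result (bind c k) = result (k (result c)).
Proof. by []. Qed.

Lemma result_step A (a : A) : result (step a) = a. Proof. by []. Qed.

Lemma result_ret A (a : A) : result (ret a) = a. Proof. by []. Qed.

Definition resultE := (result_bind, result_step, result_ret).

Lemma time_bind A B (c : timed A) (k : A -> timed B) :
  time (bind c k) = time c + time (k (result c)).
Proof. by []. Qed.

Lemma time_step A (a : A) : time (step a) = 1. Proof. by []. Qed.

Lemma time_ret A (a : A) : time (ret a) = 0. Proof. by []. Qed.

Definition timeE := (time_bind, time_step, time_ret).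

Lemma result_for_each A S (l : seq A) (body : A -> S -> timed S) s :
  result (for_each l body s) = foldl (fun s x => result (body x s)) s l.
Proof. by elim: l s => //= x l IHl s; rewrite !resultE IHl. Qed.

Lemma time_for_each_cons A S x (l : seq A) (body : A -> S -> timed S) s :
  time (for_each (x :: l) body s) =
  (time (body x s)).+1 + time (for_each l body (result (body x s))).
Proof. by rewrite /= !timeE addnA. Qed.

Lemma time_for_each (A : eqType) S (l : seq A) (body : A -> S -> timed S) s B :
  (forall x s, x \in l -> time (body x s) <= B) ->
  time (for_each l body s) <= size l * B.+1.
Proof.
elim: l s => // x l IHl s bodyB.
rewrite time_for_each_cons mulSn leq_add//.
  by rewrite ltnS bodyB// mem_head.
by apply: IHl => y s' yl; rewrite bodyB// inE yl orbT.
Qed.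

(* The lists visited by for_each_subset, in order. *)
Fixpoint sublists A (N S0 : seq A) : seq (seq A) :=
  if N is x :: N' then sublists N' S0 ++ sublists N' (x :: S0) else [:: S0].

Lemma result_for_each_subset A S (N S0 : seq A) (body : seq A -> S -> timed S) s :
  result (for_each_subset N S0 body s) =
  foldl (fun s X => result (body X s)) s (sublists N S0).
Proof.
by elim: N S0 s => //= x N IHN S0 s; rewrite !resultE foldl_cat !IHN.
Qed.

(** Chosen elements are pushed onto the accumulator one by one, so each sublist appears reversed,
    hence [catrev]. *)
Lemma mem_sublists_filter (A : eqType) (a : pred A) (N S0 : seq A) :
  catrev (seq.filter a N) S0 \in sublists N S0.
Proof.
elim: N S0 => [|x N IHN] S0 /=; first by rewrite mem_head.
by rewrite mem_cat; case: (a x) => /=; rewrite IHN ?orbT.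
Qed.

(** The recursion tree has 2^|N| leaves, each costing at most [B], and 2^|N| - 1 inner nodes, each
    costing one step; hence the strict inequality. *)
Lemma time_for_each_subset A S (N S0 : seq A) (body : seq A -> S -> timed S) s B :
  (forall X s, size X <= size N + size S0 -> time (body X s) <= B) ->
  time (for_each_subset N S0 body s) < 2 ^ size N * B.+1.
Proof.
elim: N S0 s => [|x N IHN] S0 s bodyB /=.
  by rewrite expn0 mul1n ltnS; apply: bodyB.
rewrite !timeE !resultE.
have h1 := IHN S0 s (fun X s h => bodyB X s (leqW h)).
have h2 s' : time (for_each_subset N (x :: S0) body s') < 2 ^ size N * B.+1.
  by apply: IHN => X s0 h; apply: bodyB; rewrite /= addSnnS.
by rewrite expnS -mulnA mul2n -addnn add1n -addSn leq_add.
Qed.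

End Loops.

(** * Results and costs of the subroutines and of the whole algorithm *)

Section Subroutines.
Local Open Scope nat_scope.
Variables (T : eqType) (e : rel T).
Implicit Types (v : T) (vs S : seq T) (l : seq (nat * T)).

Lemma result_compute_degree vs v : result (compute_degree e vs v) = count (e v) vs.
Proof.
rewrite /compute_degree result_for_each -[RHS]add0n.
elim: vs 0 => [|u vs IHvs] k /=; first by rewrite addn0.
by rewrite !resultE IHvs; case: (e v u); rewrite resultE /=; lia.
Qed.

Lemma time_compute_degree vs v : time (compute_degree e vs v) <= size vs * 3.
Proof.
by apply: time_for_each => u k _; rewrite !timeE /=; case: (e v u); rewrite timeE.
Qed.

Lemma perm_insert x l : perm_eq (result (insert x l)) (x :: l).
Proof.
elim: l => //= y l IHl; rewrite !resultE /=; case: ifP => _ //=.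
rewrite (perm_trans (y := [:: y, x & l])) ?perm_cons//.
by rewrite (permEl (perm_catCA [:: y] [:: x] l)).
Qed.

Lemma sorted_insert x l :
  sorted (relpre fst leq) l -> sorted (relpre fst leq) (result (insert x l)).
Proof.
elim: l => //= y l IHl yl; rewrite !resultE /=; case: ifP => [xy|xy] /=.
  by rewrite xy.
have tr : transitive (relpre (@fst nat T) leq) by move=> ? ? ?; apply: leq_trans.
rewrite path_sortedE//; rewrite path_sortedE// in yl.
case/andP: yl => yl sl; rewrite IHl ?andbT//.
by rewrite (perm_all _ (perm_insert x l)) /= yl andbT; lia.
Qed.

Lemma time_insert x l : time (insert x l) <= (size l).*2.+1.
Proof.
by elim: l => //= y l IHl; rewrite !timeE /=; case: ifP => _; rewrite !timeE; lia.
Qed.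

Definition with_degree vs v := (count (e v) vs, v).

Lemma perm_sort_by_degree vs :
  perm_eq (result (sort_by_degree e vs)) (map (with_degree vs) vs).
Proof.
rewrite /sort_by_degree result_for_each -[X in perm_eq _ X]cats0.
have: perm_eq [::] ([::] : seq (nat * T)) by [].
(* Only the list still to be inserted is generalised; the [vs] against which degrees are counted
   stays fixed. The accumulator [l] is any permutation of the tail [l'] on the right. *)
elim: {2 4}vs [::] {1 3}[::] => [|v vs' IHvs] l l' ll' //=.
rewrite !resultE /= result_compute_degree.
rewrite -cat_cons -[_ :: _]cat1s -[(_ ++ _) ++ _]catA.
rewrite perm_sym perm_catCA perm_sym; apply: IHvs.
by rewrite (perm_trans (perm_insert _ _))// perm_cons.
Qed.

Lemma sorted_sort_by_degree vs :
  sorted (relpre fst leq) (result (sort_by_degree e vs)).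
Proof.
rewrite /sort_by_degree result_for_each.
have: sorted (relpre fst leq) ([::] : seq (nat * T)) by [].
elim: {2}vs [::] => [|v vs' IHvs] l sl //=.
by apply: IHvs; rewrite !resultE /=; apply: sorted_insert.
Qed.

Lemma size_sort_by_degree vs : size (result (sort_by_degree e vs)) = size vs.
Proof. by rewrite (perm_size (perm_sort_by_degree vs)) size_map. Qed.

Lemma time_sort_by_degree vs :
  time (sort_by_degree e vs) <= size vs * (5 * size vs + 3).
Proof.
rewrite /sort_by_degree; set body := fun v l => _.
(* Invariant: vertices left plus vertices inserted never exceed [size vs], which bounds every
   insertion. *)
have: size vs + size ([::] : seq (nat * T)) <= size vs by rewrite addn0.
elim: {1 3 4}vs [::] => [|v vs' IHvs] l // lvs.
rewrite time_for_each_cons mulSn.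
have bodyE : time (body v l) <= size vs * 3 + 1 + (size l).*2.+1.
  rewrite /body !timeE -addnA leq_add ?time_compute_degree//.
  by rewrite leq_add2l time_insert.
have sizeE : size (result (body v l)) = (size l).+1.
  by rewrite /body !resultE /= (perm_size (perm_insert _ _)).
have := IHvs (result (body v l)).
rewrite sizeE addnS -addSn => /(_ lvs).
by move: lvs bodyE => /=; lia.
Qed.

Lemma result_out_neighbors v l :
  result (out_neighbors e v l) = rev (seq.filter (e v) (map snd l)).
Proof.
rewrite /out_neighbors result_for_each -[RHS]cats0 -catrevE.
elim: l [::] => //= u l IHl out; rewrite IHl !resultE /=.
by case: (e v u.2).
Qed.

Lemma time_out_neighbors v l : time (out_neighbors e v l) <= size l * 3.
Proof.
by apply: time_for_each => u k _; rewrite !timeE /=; case: (e v u.2); rewrite timeE.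
Qed.

Lemma mem_orient l1 x l2 :
  (x.2, rev (seq.filter (e x.2) (map snd l2))) \in result (orient e (l1 ++ x :: l2)).
Proof.
elim: l1 => [|u l1 IHl] /=; rewrite !resultE /= ?result_out_neighbors ?mem_head//.
by rewrite inE IHl orbT.
Qed.

Lemma orientP l p : p \in result (orient e l) ->
  exists l1 x l2, l = l1 ++ x :: l2 /\ p = (x.2, rev (seq.filter (e x.2) (map snd l2))).
Proof.
elim: l => //= v l IHl; rewrite !resultE /= result_out_neighbors inE.
case/predU1P=> [->|/IHl[l1 [u [l2 [-> ->]]]]].
  by exists [::], v, l.
by exists (v :: l1), u, l2.
Qed.

Lemma size_orient l : size (result (orient e l)) = size l.
Proof. by elim: l => //= v l ->. Qed.

Lemma time_orient l : time (orient e l) <= size l * (3 * size l + 2).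
Proof.
elim: l => //= v l IHl; rewrite !timeE.
have := time_out_neighbors v.2 l; nia.
Qed.

Lemma result_adjacent_to_all x S : result (adjacent_to_all e x S) = all (e x) S.
Proof.
rewrite /adjacent_to_all result_for_each -[RHS]andTb.
elim: S true => [|y S IHS] b /=; first by rewrite andbT.
by rewrite IHS !resultE andbA.
Qed.

Lemma result_test_clique S : result (test_clique e S) = pairwise e S.
Proof. by elim: S => //= x S IHS; rewrite !resultE /= result_adjacent_to_all IHS. Qed.

Lemma time_test_clique S : time (test_clique e S) <= size S * (3 * size S + 1).
Proof.
elim: S => //= x S IHS; rewrite !timeE.
have : time (adjacent_to_all e x S) <= size S * 3 by apply: time_for_each.
nia.
Qed.

Lemma result_compute_size S : result (compute_size S) = size S.
Proof.
rewrite /compute_size result_for_each -[RHS]addn0.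
by elim: S 0 => //= x S IHS k; rewrite IHS addnS.
Qed.

Lemma time_compute_size S : time (compute_size S) <= size S * 2.
Proof. exact: time_for_each. Qed.

(** The value 0 on non-cliques turns each conditional update into [maxn m (score S)], so the loops
    become nested maxima. *)
Definition score S := if pairwise e S then size S else 0.

Lemma foldl_maxn (A : Type) (body : nat -> A -> nat) (f : A -> nat) (s : seq A) m :
  (forall m x, body m x = maxn m (f x)) ->
  foldl body m s = maxn m (\max_(x <- s) f x).
Proof.
move=> bodyE; elim: s m => [|x s IHs] m /=; first by rewrite big_nil maxn0.
by rewrite IHs bodyE big_cons maxnA.
Qed.

Lemma result_MaximalClique vs :
  result (MaximalClique e vs) =
  \max_(p <- result (build_oriented e vs))
    \max_(S <- sublists (p.1 :: p.2) [::]) score S.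
Proof.
rewrite /MaximalClique !resultE result_for_each -[RHS]max0n.
apply: foldl_maxn => m p; cbv beta.
rewrite result_bind result_step result_for_each_subset; apply: foldl_maxn => {}m S.
rewrite !resultE result_test_clique /score; case: pairwise.
  by rewrite !resultE result_compute_size.
by rewrite maxn0.
Qed.

Lemma time_MaximalClique vs K :
  (forall p, p \in result (build_oriented e vs) -> size p.2 <= K) ->
  time (MaximalClique e vs) <= 80 * (size vs).+1 ^ 2 * 8 ^ K.
Proof.
move=> outK; rewrite /MaximalClique time_bind [X in _ + X]time_bind time_step.
set n := size vs.
have buildB : time (build_oriented e vs) <= n * (8 * n + 5).
  rewrite /build_oriented !timeE.
  have := time_sort_by_degree vs.
  have := time_orient (result (sort_by_degree e vs)).
  by rewrite size_sort_by_degree -/n; nia.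
have sizeG : size (result (build_oriented e vs)) = n.
  by rewrite /build_oriented !resultE size_orient size_sort_by_degree.
set body := fun p m => _.
(* Testing and measuring a list of size s <= K+1 costs at most 4(s+1)^2, and s+1 <= 2^(K+1). With
   2^(K+1) sublists per vertex this yields the base 8 = 2 * 4. *)
set c := 4 * 4 ^ K.+1.
have bodyB p m : p \in result (build_oriented e vs) ->
    time (body p m) <= 1 + 2 ^ K.+1 * c.+1.
  move=> /outK pK; rewrite /body !timeE leq_add2l.
  apply: (@leq_trans (2 ^ size (p.1 :: p.2) * c.+1)); last first.
    by rewrite leq_mul2r leq_exp2l.
  apply/ltnW/time_for_each_subset => S m' /= sizeS.
  rewrite !timeE.
  have sizeSK : (size S).+1 <= 2 ^ K.+1.
    apply: leq_ltn_trans (ltn_expl K.+1 _) => //; move: sizeS pK => /=; lia.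
  have := time_test_clique S.
  have : time (if result (test_clique e S)
    then let* k := compute_size S in step (maxn m' k) else ret m') <= size S * 2 + 1.
    case: ifP => _; rewrite ?timeE //.
    by rewrite leq_add2r time_compute_size.
  have : 4 * (size S).+1 ^ 2 <= c.
    by rewrite /c leq_mul2l /= (_ : 4 = 2 ^ 2)// -expnM mulnC expnM leq_exp2r.
  by rewrite -mulnn; set a := time _; set b := time _; nia.
have := time_for_each (result (step 0)) bodyB.
rewrite sizeG.
have -> : 2 ^ K.+1 * c.+1 = 32 * 8 ^ K + 2 * 2 ^ K.
  by rewrite /c (_ : 8 = 2 * 4)// expnMn !expnS; lia.
have : 2 ^ K <= 8 ^ K by case: (K) => [|k]//; rewrite leq_exp2r.
have : 0 < 8 ^ K by rewrite expn_gt0.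
rewrite -mulnn.
move: (8 ^ K) (2 ^ K) => x y x0 yx; set a := time (for_each _ _ _) => aB.
have {aB yx} aB : a <= n * (34 * x + 2) by nia.
have : 8 * (n * n) + 7 * n + 1 <= (8 * (n * n) + 7 * n + 1) * x by rewrite leq_pmulr.
nia.
Qed.

End Subroutines.

(** * Correctness, and the degrees of out-neighbours *)

Section Cliques.
Local Open Scope nat_scope.
Variables (T : finType) (e : rel T).
Hypotheses (e_sym : symmetric e) (e_irr : irreflexive e).
Implicit Types (v : T) (vs S : seq T) (C : {set T}).

Lemma is_cliqueP C :
  reflect {in C &, forall x y, x != y -> e x y} (is_clique e C).
Proof.
apply: (iffP forall_inP) => [CP x y xC yC xy|CP x xC].
  by have /forall_inP/(_ y yC)/implyP := CP x xC; apply.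
by apply/forall_inP => y yC; apply/implyP; apply: CP.
Qed.

Lemma pairwise_uniq S : pairwise e S -> uniq S.
Proof.
rewrite uniq_pairwise; apply: sub_pairwise => x y /= exy.
by apply: contraTneq exy => ->; rewrite e_irr.
Qed.

Lemma pairwise_is_clique S : pairwise e S -> is_clique e [set x in S].
Proof.
move=> pS; apply/is_cliqueP => x y; rewrite !inE.
elim: S pS => //= z S IHS /andP[/allP zS pS].
rewrite !inE => /predU1P[->|xS] /predU1P[->|yS]; last exact: IHS.
- by rewrite eqxx.
- by move=> _; apply: zS.
- by move=> _; rewrite e_sym; apply: zS.
Qed.

Lemma is_clique_pairwise C S :
  is_clique e C -> {subset S <= C} -> uniq S -> pairwise e S.
Proof.
move=> /is_cliqueP cC SC; rewrite uniq_pairwise.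
by apply: (sub_in_pairwise (P := mem C)) => [x y /= xC yC|]; [exact: cC|exact/allP].
Qed.

Section Order.
Variable vs : seq T.
Hypothesis vsT : perm_eq vs (enum T).
Let l := result (sort_by_degree e vs).

Lemma count_deg v : count (e v) vs = deg e v.
Proof.
rewrite (permP vsT) enumT /deg cardsE cardE /enum_mem size_filter; exact: eq_count.
Qed.

Lemma perm_sorted_vertices : perm_eq (map snd l) vs.
Proof.
rewrite (perm_trans (perm_map snd (perm_sort_by_degree e vs)))//.
by rewrite -map_comp map_id.
Qed.

Lemma uniq_sorted_vertices : uniq (map snd l).
Proof. by rewrite (perm_uniq perm_sorted_vertices) (perm_uniq vsT) enum_uniq. Qed.

Lemma mem_sorted_vertices v : v \in map snd l.
Proof. by rewrite (perm_mem perm_sorted_vertices) (perm_mem vsT) mem_enum. Qed.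

Lemma sorted_fst x : x \in l -> x.1 = deg e x.2.
Proof.
rewrite (perm_mem (perm_sort_by_degree e vs)) => /mapP[v _ ->] /=.
exact: count_deg.
Qed.

Lemma MaximalClique_correct : result (MaximalClique e vs) = clique_number e.
Proof.
rewrite result_MaximalClique /clique_number; apply/eqP; rewrite eqn_leq; apply/andP; split.
  apply/bigmax_leqP_seq => p _ _; apply/bigmax_leqP_seq => S _ _.
  rewrite /score; case: ifP => // pS.
  rewrite -(card_uniqP (pairwise_uniq pS)) -cardsE.
  exact: (leq_bigmax_cond [set x in S] (pairwise_is_clique pS)).
apply/bigmax_leqP => C cC.
have [->|/finset.set0Pn[v vC]] := eqVneq C finset.set0; first by rewrite cards0.
have hC : has (fun u => u.2 \in C) l.
  have /mapP[u ul vE] := mem_sorted_vertices v.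
  by apply/hasP; exists u; rewrite // -vE.
have := uniq_sorted_vertices; have := mem_sorted_vertices.
have orientl := mem_orient e _ _ _.
rewrite /build_oriented result_bind -/l.
(* [x] carries the earliest vertex of [C]: no vertex of [l1] is in [C]. *)
case: (split_find hC) orientl => x l1 l2 xC l1C orientl meml.
rewrite cat_rcons map_cat cat_uniq => /and3P[_ _ /= /andP[xl2 ul2]].
apply: leq_trans (leq_bigmax_seq _ (orientl l1 x l2) isT) => //=.
set out := rev _.
have sub := mem_sublists_filter (mem C) (x.2 :: out) [::].
apply: leq_trans (leq_bigmax_seq _ sub isT).
set S := catrev _ _.
have uout : uniq (x.2 :: out).
  by rewrite /= mem_rev rev_uniq filter_uniq// mem_filter (negbTE xl2) andbF.
have uS : uniq S by rewrite /S catrevE cats0 rev_uniq filter_uniq.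
(* A vertex of [C] other than [x.2] cannot occur in [l1], so it occurs in [l2]; being adjacent to
   [x.2], it is in [out]. *)
have memS : S =i C.
  move=> y; rewrite /S catrevE cats0 mem_rev mem_filter.
  rewrite -[RHS]andbT; apply: andb_id2l => yC.
  rewrite inE mem_rev mem_filter; have [//|yx] := eqVneq y x.2.
  have := meml y; rewrite cat_rcons map_cat mem_cat /= inE (negbTE yx) /=.
  case/orP => [/mapP[u ul1 yu]|->].
    by case/hasP: l1C; exists u; rewrite // -yu.
  by rewrite andbT; move/is_cliqueP: cC; apply=> //; rewrite eq_sym.
rewrite /score (is_clique_pairwise cC)//; last by move=> y; rewrite memS.
by rewrite -(card_uniqP uS) (eq_card memS).
Qed.

(* An out-neighbour of v has degree at least deg v, which is at least the
   out-degree of v. *)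
Lemma outdegree_card p : p \in result (build_oriented e vs) ->
  size p.2 <= #|[set v | size p.2 <= deg e v]|.
Proof.
rewrite /build_oriented result_bind -/l => /orientP[l1 [x [l2 [lE ->]]]] /=.
set out := rev _.
have : uniq (map snd l2).
  by have := uniq_sorted_vertices; rewrite lE map_cat cat_uniq => /and4P[].
move=> ul2; have uout : uniq out by rewrite rev_uniq filter_uniq.
have degx : size out <= deg e x.2.
  rewrite -(card_uniqP uout); apply/subset_leq_card/fintype.subsetP => u.
  by rewrite mem_rev mem_filter inE => /andP[].
rewrite -{1}(card_uniqP uout); apply/subset_leq_card/fintype.subsetP => u.
rewrite mem_rev mem_filter inE => /andP[_ /mapP[y yl2 ->]].
apply: (leq_trans degx).
have xl : x \in l by rewrite lE mem_cat mem_head orbT.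
have yl : y \in l by rewrite lE mem_cat inE yl2 !orbT.
rewrite -sorted_fst// -[X in _ <= X]sorted_fst//.
have := sorted_sort_by_degree e vs; rewrite -/l lE.
have tr : transitive (relpre (@fst nat T) leq) by move=> ? ? ?; apply: leq_trans.
rewrite sorted_pairwise// pairwise_cat => /and3P[_ _ /= /andP[/allP + _]].
exact.
Qed.

End Order.
End Cliques.

(** * From the power law bound to a bound on out-degrees *)

Section PowerLaw.
Variables (R : realType) (c1 alpha t : R).
Hypotheses (c1_gt0 : 0 < c1) (alpha_gt1 : 1 < alpha) (t_ge0 : 0 <= t).

Let r : R := 2 `^ (1 - alpha).

Lemma ratio_lt1 : r < 1.
Proof.
rewrite /r /powR pnatr_eq0/= -[ltRHS]expR0 ltr_expR.
by rewrite pmulr_llt0 ?ln_gt0 ?ltr1n// subr_lt0.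
Qed.

Variables (T : finType) (e : rel T).
Hypothesis plb : power_law_bounded e c1 alpha t.

Let B : R := c1 * #|T|%:R * (t + 1) `^ (alpha - 1).

Lemma B_ge0 : 0 <= B.
Proof. by rewrite !mulr_ge0 ?powR_ge0 ?(ltW c1_gt0). Qed.

Lemma expr_ratio d : r ^+ d = (2 ^ d)%:R `^ (1 - alpha).
Proof. by rewrite natrX -!powR_mulrn ?powR_ge0// /r powRAC. Qed.

(** As t >= 0, each of the 2^d summands is at most (2^d)^(-alpha), and 2^d (2^d)^(-alpha) = r^d. *)
Lemma card_block d :
  #|[set v | (2 ^ d <= deg e v < 2 ^ d.+1)%N]|%:R <= B * r ^+ d.
Proof.
apply: (le_trans (plb d)); apply: ler_wpM2l B_ge0 _ _ _.
have p2 : 0 < (2 ^ d)%:R :> R by rewrite ltr0n expn_gt0.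
apply: (@le_trans _ _ (\sum_(2 ^ d <= i < 2 ^ d.+1) (2 ^ d)%:R `^ (- alpha))).
  rewrite big_nat [leRHS]big_nat; apply: ler_sum => i /andP[di _].
  have di' : (2 ^ d)%:R <= i%:R + t.
    by rewrite (le_trans (_ : _ <= i%:R)) ?ler_nat ?lerDl.
  have it0 : 0 < i%:R + t by apply: lt_le_trans di'.
  rewrite !powRN lef_pV2 ?posrE ?powR_gt0//.
  by apply: ge0_ler_powR; rewrite ?nnegrE// ltW// (lt_trans ltr01).
rewrite sumr_const_nat expnS mul2n -addnn addnK -[leLHS]mulr_natl expr_ratio.
by rewrite -{1}[(2 ^ d)%:R]powRr1 ?(ltW p2)// -powRD ?lexx// (gt_eqF p2) implybT.
Qed.

(** Finite geometric sum of the block bounds, multiplied through by 1 - r so that the induction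
    telescopes. *)
Lemma card_blocks a j :
  #|[set v | (2 ^ a <= deg e v < 2 ^ (a + j))%N]|%:R * (1 - r) <=
  B * (r ^+ a - r ^+ (a + j)).
Proof.
have r1 : 0 <= 1 - r by rewrite subr_ge0 ltW ?ratio_lt1.
elim: j => [|j IHj].
  rewrite addn0 subrr mulr0 (_ : [set v | _] = finset.set0) ?cards0 ?mul0r//.
  by apply/finset.setP => v; rewrite !inE; case: leqP => //= h; rewrite leqNgt.
rewrite addnS.
apply: (@le_trans _ _
  ((#|[set v | (2 ^ a <= deg e v < 2 ^ (a + j))%N]|%:R +
    #|[set v | (2 ^ (a + j) <= deg e v < 2 ^ (a + j).+1)%N]|%:R) * (1 - r))).
  rewrite ler_wpM2r// -natrD ler_nat.
  apply: leq_trans (leq_card_setU _ _).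
  apply/subset_leq_card/fintype.subsetP => v; rewrite !inE => /andP[-> ->] /=.
  by rewrite andbT; case: ltnP.
have := ler_wpM2r r1 (card_block (a + j)).
by rewrite exprS; move: IHj; lra.
Qed.

(** Round k down to a power p = 2^a, at the price of the factor 2. At least p vertices have degree
    at least p, so p (1 - r) <= B p^(1-alpha), that is p^alpha <= B / (1 - r); take the alpha-th
    root. *)
Lemma outdegree_bound k :
  (k <= #|[set v | (k <= deg e v)%N]|)%N ->
  k%:R <= 2 * (c1 / (1 - r)) `^ (1 / alpha) *
          (#|T|%:R `^ (1 / alpha) * (t + 1) `^ (1 - 1 / alpha)).
Proof.
have r1 : 0 < 1 - r by rewrite subr_gt0 ratio_lt1.
have alpha_gt0 : 0 < alpha by rewrite (lt_trans ltr01).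
case: (posnP k) => [-> _|k_gt0 kdeg].
  by rewrite !mulr_ge0 ?powR_ge0.
have /andP[pk kp] := trunc_log_bounds (isT : (1 < 2)%N) k_gt0.
set a := trunc_log 2 k in pk kp.
set p : R := (2 ^ a)%:R.
have p_gt0 : 0 < p by rewrite ltr0n expn_gt0.
have kp2 : k%:R <= 2 * p by rewrite -natrM ler_nat -expnS ltnW.
have h : p * (1 - r) <= B * r ^+ a.
  (* [#|T|] blocks reach every degree, since a degree is at most n < 2^n <= 2^(a+n). *)
  apply: (@le_trans _ _ (B * (r ^+ a - r ^+ (a + #|T|)))); last first.
    by rewrite ler_wpM2l ?B_ge0 ?gerBl ?exprn_ge0 ?powR_ge0.
  apply: le_trans (card_blocks a #|T|); rewrite ler_wpM2r ?(ltW r1)// ler_nat.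
  apply: (leq_trans pk); apply: (leq_trans kdeg).
  apply/subset_leq_card/fintype.subsetP => v; rewrite !inE => kv.
  rewrite (leq_trans pk)//=; apply: (@leq_ltn_trans #|T|); first exact: max_card.
  by rewrite (leq_trans (ltn_expl _ (isT : (1 < 2)%N)))// leq_exp2l// leq_addl.
have {h} h : p `^ alpha <= B / (1 - r).
  rewrite ler_pdivlMr// -(ler_pM2r (powR_gt0 (1 - alpha) p_gt0)).
  rewrite mulrAC -powRD; last by rewrite (gt_eqF p_gt0) implybT.
  by rewrite addrC subrK powRr1 ?(ltW p_gt0)// -expr_ratio.
have alphaV : 0 <= 1 / alpha by rewrite divr_ge0 ?ltW.
have := ge0_ler_powR alphaV _ _ h.
rewrite !nnegrE powR_ge0 => /(_ isT).
have B0 : 0 <= B / (1 - r) by rewrite divr_ge0 ?B_ge0 ?ltW.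
move=> /(_ B0).
rewrite -powRrM mul1r mulfV ?gt_eqF// powRr1 ?(ltW p_gt0)//.
have -> : B / (1 - r) = c1 / (1 - r) * (#|T|%:R * (t + 1) `^ (alpha - 1)).
  by rewrite /B; ring.
rewrite powRM ?mulr_ge0 ?powR_ge0 ?invr_ge0 ?(ltW c1_gt0) ?(ltW r1)//.
rewrite [(#|T|%:R * _) `^ _]powRM ?powR_ge0// -powRrM.
have -> : (alpha - 1) * alpha^-1 = 1 - alpha^-1.
  by rewrite mulrBl mulfV ?gt_eqF// mul1r.
by move=> h'; rewrite (le_trans kp2)// -mulrA ler_wpM2l.
Qed.

End PowerLaw.

(** * Absorbing the polynomial factor, and the theorem *)

(** With y = n^(1/alpha), raise y <= 1 + y <= exp(y) to the power alpha. *)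
Lemma natr_le_expR (R : realType) (alpha : R) n :
  0 < alpha -> n%:R <= expR (alpha * n%:R `^ (1 / alpha)).
Proof.
move=> alpha_gt0; set y := _ `^ _.
have y0 : 0 <= y by rewrite powR_ge0.
have -> : n%:R = y `^ alpha.
  by rewrite /y -powRrM div1r mulVf ?gt_eqF// powRr1.
rewrite mulrC expRM ge0_ler_powR ?nnegrE ?expR_ge0 ?(ltW alpha_gt0)//.
by apply: le_trans (expR_ge1Dx y); rewrite lerDr.
Qed.

Theorem theorem5p9 (R : realType) (c1 alpha : R)
    (c1_gt0 : 0 < c1) (alpha_gt1 : 1 < alpha) :
  exists C : R, 0 < C /\
    forall (T : finType) (e : rel T) (t : R) (vs : seq T),
      symmetric e -> irreflexive e -> 0 <= t ->
      power_law_bounded e c1 alpha t ->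
      perm_eq vs (enum T) ->
      result (MaximalClique e vs) = clique_number e /\
      (time (MaximalClique e vs))%:R <=
        expR (C * (#|T|%:R `^ (1 / alpha) * (t + 1) `^ (1 - 1 / alpha))).
Proof.
have alpha_gt0 : 0 < alpha by rewrite (lt_trans ltr01).
pose M : R := 2 * (c1 / (1 - 2 `^ (1 - alpha))) `^ (1 / alpha).
have M0 : 0 <= M by rewrite mulr_ge0 ?powR_ge0.
(* The three terms pay for the factors 320, n^2 and 8^K, using z <= exp(z) for z = 320 and z = 8. *)
exists (320 + 2 * alpha + 8 * M); split; first by lra.
move=> T e t vs e_sym e_irr t_ge0 plb vsT.
split; first exact: MaximalClique_correct.
set X := _ * (t + 1) `^ _.
have sizevs : size vs = #|T| by rewrite (perm_size vsT) cardE.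
(* For n = 0 the exponent vanishes and the bound is 1, exactly the one step that initialises m.
   Otherwise X >= 1, which lets constants be absorbed. *)
have [T0|T_gt0] := posnP #|T|.
  have -> : vs = [::] by apply: size0nil; rewrite sizevs.
  rewrite /X T0 powR0 ?mul0r ?mulr0 ?expR0//.
  by rewrite div1r invr_eq0 gt_eqF.
have X_ge_n : #|T|%:R `^ (1 / alpha) <= X.
  rewrite ler_peMr ?powR_ge0// -[leLHS](powRr0 (t + 1)) ler_powR ?lerDr//.
  by rewrite subr_ge0 ler_pdivrMr// mul1r ltW.
have X1 : 1 <= X.
  rewrite (le_trans _ X_ge_n)// -[leLHS](powRr0 (#|T|%:R)) ler_powR ?ler1n//.
  by rewrite divr_ge0// ltW.
have MX0 : 0 <= M * X by rewrite mulr_ge0// (le_trans ler01).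
have outK p : p \in result (build_oriented e vs) -> (size p.2 <= Num.truncn (M * X))%N.
  move=> pG; rewrite truncn_ge_nat//.
  exact: (outdegree_bound c1_gt0 alpha_gt1 t_ge0 plb (outdegree_card vsT pG)).
have := time_MaximalClique outK; rewrite sizevs.
set K := Num.truncn _ => timeK.
have KX : K%:R <= M * X by rewrite truncn_le.
(* 80 (n+1)^2 <= 320 n^2 because n >= 1. *)
apply: (@le_trans _ _ (320 * #|T|%:R ^+ 2 * 8 ^+ K)).
  rewrite -!natrX -!natrM ler_nat (leq_trans timeK)// leq_mul2r.
  by apply/orP; right; rewrite -!mulnn; nia.
have -> : (320 + 2 * alpha + 8 * M) * X = 320 * X + 2 * alpha * X + 8 * M * X by ring.
rewrite !expRD ler_pM ?mulr_ge0 ?exprn_ge0//.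
- rewrite ler_pM ?exprn_ge0//.
    have h : 320 <= expR (320 : R) by rewrite (le_trans _ (expR_ge1Dx _)) ?lerDr.
    by rewrite (le_trans h)// ler_expR; lra.
  rewrite -mulrA mulrC expRM_natr lerXn2r ?nnegrE ?expR_ge0//.
  by rewrite (le_trans (natr_le_expR _ alpha_gt0))// ler_expR ler_pM2l.
- have h : 8 <= expR (8 : R) by rewrite (le_trans _ (expR_ge1Dx _)) ?lerDr.
  apply: (@le_trans _ _ (expR 8 ^+ K)); first by rewrite lerXn2r ?nnegrE ?expR_ge0.
  by rewrite -expRM_natr ler_expR -mulrA ler_pM2l.
Qed.
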